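(* The following two assertions are equivalent: (1) (Jónsson's conjecture) Every finite lattice that is semidistributive and satisfies Whitman's condition is isomorphic to a sublattice of a free lattice. (2) No S-lattice contains a cycle of minimal pairs $\{\langle p_k ; J_k\rangle : k = 1,2,\dots,n\}$ with $n \geq 3$ such that $$|\{\,1 \leq k \leq n : \{p_k\} \ll J_{k+1}\,\}| \leq n/2,$$ where addition of indices is done modulo $n$ (so $J_{n+1} = J_1$).
   Context: Join and meet are written $+$ (or $\bigvee$) and juxtaposition (or $\bigwedge$). A lattice is semidistributive if it satisfies both $(SD_\vee)$: $x = a+b = a+c$ implies $x = a + bc$, and $(SD_\wedge)$: $x = ab = ac$ implies $x = a(b+c)$. Whitman's condition $(W)$: for all $a,b,c,d$, if $ab \leq c+d$ then $a \leq c+d$ or $b \leq c+d$ or $ab \leq c$ or $ab \leq d$. An S-lattice is a finite semidistributive lattice satisfying Whitman's condition. For subsets $X, Y$ of a lattice, $X \ll Y$ means that for every $x \in X$ there is $y \in Y$ with $x \leq y$; in particular $\{p\} \ll Y$ means $p \leq y$ for some $y \in Y$. Minimal pair: let $L$ be a finite lattice, $a \in L$ and $B \subseteq L$. Then $\langle a ; B\rangle$ is a (join) minimal pair if $a \leq \bigvee B$ and, for every $B' \subseteq L$ with $a \leq \bigvee B'$ and $B' \ll B$, one has $B \subseteq B'$. Cycle of minimal pairs: a family $\{\langle p_k ; J_k\rangle : k = 1,\dots,n\}$ of minimal pairs in $L$ such that $p_{k+1} \in J_k$ for every $k = 1,\dots,n$, with indices taken modulo $n$ (so $p_1 \in J_n$).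 *)

(* Defs.v *)
From mathcomp Require Import all_boot all_order.

Set Implicit Arguments.
Unset Strict Implicit.
Unset Printing Implicit Defensive.

Import Order.Theory.
Local Open Scope order_scope.

Section LatticeConditions.

Context {d : Order.disp_t}.
Variable L : latticeType d.

Definition join_semidistributive : Prop :=
  forall x a b c : L, x = a `|` b -> x = a `|` c -> x = a `|` (b `&` c).

Definition meet_semidistributive : Prop :=
  forall x a b c : L, x = a `&` b -> x = a `&` c -> x = a `&` (b `|` c).

Definition semidistributive : Prop :=
  join_semidistributive /\ meet_semidistributive.

Definition whitman : Prop :=
  forall a b c d : L, a `&` b <= c `|` d ->
    [\/ a <= c `|` d, b <= c `|` d, a `&` b <= c | a `&` b <= d].

End LatticeConditions.

(* The type finTBLatticeType is that of all nonempty finite lattices: a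
   nonempty finite lattice is automatically bounded.  The bounds are not
   preserved by {lmorphism _ -> _}. *)
Definition S_lattice {d : Order.disp_t} (L : finTBLatticeType d) : Prop :=
  semidistributive L /\ whitman L.

(* The universal property among all lattices, so bounds, if any, are not
   part of the signature. *)
Definition freely_generated {d : Order.disp_t} (F : latticeType d)
    (X : Type) (i : X -> F) : Prop :=
  forall (d' : Order.disp_t) (M : latticeType d') (f : X -> M),
  exists2 h : {lmorphism F -> M}, (forall x, h (i x) = f x) &
    forall h' : {lmorphism F -> M}, (forall x, h' (i x) = f x) -> h' =1 h.

Definition is_free_lattice {d : Order.disp_t} (F : latticeType d) : Prop :=
  exists (X : Type) (i : X -> F), freely_generated i.

(* S ranges over the predicates on F closed under meets and joins, and f is
   an isomorphism of L onto S. *)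
Definition isomorphic_to_sublattice {d d' : Order.disp_t}
    (L : latticeType d) (F : latticeType d') : Prop :=
  exists (S : latticeClosed F) (f : {lmorphism L -> F}),
    injective f /\ forall y : F, y \in S <-> exists x : L, f x = y.

Section MinimalPairs.

Context {d : Order.disp_t}.
Variable L : finTBLatticeType d.

Definition refines (X Y : {set L}) : bool :=
  [forall x in X, exists y in Y, x <= y].

Definition minimal_pair (a : L) (B : {set L}) : Prop :=
  a <= \join_(b in B) b /\
  forall B' : {set L},
    a <= \join_(b in B') b -> refines B' B -> B \subset B'.

(* Indices run over 0, ..., n-1, and ordS is the successor modulo n. *)
Definition minimal_pair_cycle (n : nat) (p : 'I_n -> L) (J : 'I_n -> {set L}) :
    Prop :=
  (forall k, minimal_pair (p k) (J k)) /\ (forall k, p (ordS k) \in J k).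

End MinimalPairs.

(* Main.v *)
(** The definition of minimal pairs admits the trivial pairs <a; {a}>.  Padding
a cycle of nontrivial pairs with trivial ones makes the count in (2) zero, so
(2) says that the dependency relation "a is different from b and b lies in B
for some minimal pair <a; B>" is acyclic in every S-lattice.

If L embeds in a free lattice F, then L embeds in the term model FL(F).  For a
term t let t^ be the least element of L above t.  If t^ = p and <p; J> is a
minimal pair with q in J, then Whitman's condition in FL(F) breaks t up into
subterms, each below a member of J, whose approximations cover p; minimality
makes q one of them, so q = s^ with s = t or s shorter than t.  Around a cycle
the size cannot drop, hence the cycle is constant and its count is n.

Conversely, acyclicity allows to define, by recursion, from a monotone section
f of the evaluation FL(L) -> L a join-preserving section a |-> f a /\ (meet of
\/ H(B) over the nontrivial minimal pairs <a; B>) =: H a.  Whitman's condition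
in L makes H preserve meets if f does.  As the dual of an S-lattice is an
S-lattice, the dual construction applies to H and turns it into a section
preserving both operations. *)
Require Import Defs.
From HB Require Import structures.
From mathcomp Require Import all_boot all_order.

Set Implicit Arguments.
Unset Strict Implicit.
Unset Printing Implicit Defensive.

Import Order.Theory.
Local Open Scope order_scope.
Local Open Scope quotient_scope.

(** * Whitman's term model of free lattices *)

Inductive lterm (X : Type) : Type :=
  | LVar of X
  | LJoin of lterm X & lterm X
  | LMeet of lterm X & lterm X.

Section TermChoice.
Variable X : Type.

(** Generic trees only serve to equip terms with the choice structure that the quotient by
    [lterm_equiv] requires. *)
Fixpoint lterm_tree (t : lterm X) : GenTree.tree X :=
  match t with
  | LVar x => GenTree.Leaf x
  | LJoin t1 t2 => GenTree.Node 0 [:: lterm_tree t1; lterm_tree t2]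
  | LMeet t1 t2 => GenTree.Node 1 [:: lterm_tree t1; lterm_tree t2]
  end.

Fixpoint tree_lterm (u : GenTree.tree X) : option (lterm X) :=
  match u with
  | GenTree.Leaf x => Some (LVar x)
  | GenTree.Node n [:: u1; u2] =>
      if (tree_lterm u1, tree_lterm u2) is (Some t1, Some t2)
      then Some (if n is 0 then LJoin t1 t2 else LMeet t1 t2) else None
  | _ => None
  end.

Lemma lterm_treeK : pcancel lterm_tree tree_lterm.
Proof. by elim=> //= [t1 -> t2 ->|t1 -> t2 ->]. Qed.

End TermChoice.

HB.instance Definition _ (X : choiceType) :=
  Choice.copy (lterm X) (pcan_type (@lterm_treeK X)).

Fixpoint lterm_size (X : Type) (t : lterm X) : nat :=
  match t with
  | LVar _ => 0
  | LJoin t1 t2 | LMeet t1 t2 => (lterm_size t1 + lterm_size t2).+1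
  end.

Section WhitmanOrder.
Variable X : eqType.
Implicit Types s t u : lterm X.

(** Whitman's decision procedure for the word problem. The inner fixpoints let the recursion descend
    in [t] while [s] stays fixed; the clause for a meet below a join is condition (W). *)
Fixpoint lterm_le s : pred (lterm X) :=
  match s with
  | LVar x => fix le_var t := match t with
      | LVar y => x == y
      | LJoin t1 t2 => le_var t1 || le_var t2
      | LMeet t1 t2 => le_var t1 && le_var t2
      end
  | LJoin s1 s2 => fun t => lterm_le s1 t && lterm_le s2 t
  | LMeet s1 s2 => fix le_meet t := match t with
      | LVar _ => lterm_le s1 t || lterm_le s2 t
      | LJoin t1 t2 =>
          [|| lterm_le s1 t, lterm_le s2 t, le_meet t1 | le_meet t2]
      | LMeet t1 t2 => le_meet t1 && le_meet t2
      end
  end.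

Lemma lterm_le_meetr s t1 t2 :
  lterm_le s (LMeet t1 t2) = lterm_le s t1 && lterm_le s t2.
Proof. by elim: s => //= s1 -> s2 ->; rewrite andbACA. Qed.

Lemma lterm_le_joinl s t1 t2 : lterm_le s t1 -> lterm_le s (LJoin t1 t2).
Proof.
elim: s => /= [x ->|s1 IH1 s2 IH2 /andP[/IH1 -> /IH2 ->]|s1 _ s2 _ ->] //.
by rewrite !orbT.
Qed.

Lemma lterm_le_joinr s t1 t2 : lterm_le s t2 -> lterm_le s (LJoin t1 t2).
Proof.
elim: s => /= [x ->|s1 IH1 s2 IH2 /andP[/IH1 -> /IH2 ->]|s1 _ s2 _ ->] //;
by rewrite !orbT.
Qed.

Lemma lterm_le_meetl s1 s2 t :
  lterm_le s1 t || lterm_le s2 t -> lterm_le (LMeet s1 s2) t.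
Proof.
elim: t => //= [t1 _ t2 _ /orP[]->|t1 IH1 t2 IH2]; rewrite ?orbT //.
rewrite !lterm_le_meetr => /orP[]/andP[h1 h2].
  by rewrite IH1 ?IH2 ?h1 ?h2.
by rewrite IH1 ?IH2 ?h1 ?h2 ?orbT.
Qed.

Lemma lterm_le_refl : reflexive lterm_le.
Proof.
elim=> [x|t1 IH1 t2 IH2|t1 IH1 t2 IH2]; first exact: eqxx.
  by apply/andP; split; [apply: lterm_le_joinl|apply: lterm_le_joinr].
by rewrite lterm_le_meetr !lterm_le_meetl ?IH1 ?IH2 ?orbT.
Qed.

(** This is cut elimination: induction on the middle term, and inside it on the left term if the
    middle one is a variable or a join, on the right term if it is a meet. *)
Lemma lterm_le_trans : transitive lterm_le.
Proof.
elim=> [y|t1 IHt1 t2 IHt2|t1 IHt1 t2 IHt2] s u.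
- elim: s u => [x|s1 IH1 s2 IH2|s1 IH1 s2 IH2] u.
  + by move=> /eqP ->.
  + by case/andP=> /IH1 h1 /IH2 h2 /= yu; rewrite h1 ?h2.
  + by case/orP=> [/IH1 h|/IH2 h] /h us; apply: lterm_le_meetl; rewrite us ?orbT.
- elim: s u => [x|s1 IH1 s2 IH2|s1 IH1 s2 IH2] u.
  + by case/orP=> [h|h] /andP[h1 h2]; [apply: IHt1 h1|apply: IHt2 h2].
  + by case/andP=> /IH1 h1 /IH2 h2 yu; rewrite /= h1 ?h2.
  + case/or4P=> [/IH1 h /h us|/IH2 h /h us|h /andP[h1 _]|h /andP[_ h2]].
    * by apply: lterm_le_meetl; rewrite us.
    * by apply: lterm_le_meetl; rewrite us orbT.
    * exact: IHt1 h1.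
    * exact: IHt2 h2.
- rewrite lterm_le_meetr => /andP[st1 st2].
  elim: u => [z|u1 IH1 u2 IH2|u1 IH1 u2 IH2].
  + by case/orP=> h; [apply: IHt1 h|apply: IHt2 h].
  + case/or4P=> [h|h|/IH1 h|/IH2 h].
    * exact: IHt1 h.
    * exact: IHt2 h.
    * exact: lterm_le_joinl.
    * exact: lterm_le_joinr.
  + by rewrite !lterm_le_meetr => /andP[/IH1 -> /IH2 ->].
Qed.

Definition lterm_equiv s t := lterm_le s t && lterm_le t s.

Lemma lterm_equiv_refl : reflexive lterm_equiv.
Proof. by move=> t; rewrite /lterm_equiv lterm_le_refl. Qed.

Lemma lterm_equiv_sym : symmetric lterm_equiv.
Proof. by move=> s t; rewrite /lterm_equiv andbC. Qed.

Lemma lterm_equiv_trans : transitive lterm_equiv.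
Proof.
move=> t s u /andP[st ts] /andP[tu ut].
by apply/andP; split; [apply: lterm_le_trans tu|apply: lterm_le_trans ts].
Qed.

End WhitmanOrder.

Canonical lterm_equiv_equiv (X : eqType) :=
  EquivRel (@lterm_equiv X) (@lterm_equiv_refl X) (@lterm_equiv_sym X)
    (@lterm_equiv_trans X).

Definition free_lattice (X : choiceType) : Type := {eq_quot (@lterm_equiv X)}.

HB.instance Definition _ (X : choiceType) := Choice.on (free_lattice X).
HB.instance Definition _ (X : choiceType) :=
  EqQuotient.on (free_lattice X).

Fact free_lattice_display : Order.disp_t. Proof. exact: Order.Disp tt tt. Qed.

Section FreeLattice.
Variable X : choiceType.
Local Notation FL := (free_lattice X).
Implicit Types a b c : FL.

Definition fl_class (t : lterm X) : FL := \pi_FL t.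

Lemma fl_classK a : fl_class (repr a) = a.
Proof. exact: reprK. Qed.

Definition fl_le a b : bool := lterm_le (repr a) (repr b).
Definition fl_lub a b : FL := fl_class (LJoin (repr a) (repr b)).
Definition fl_glb a b : FL := fl_class (LMeet (repr a) (repr b)).

Lemma repr_class_equiv (t : lterm X) : lterm_equiv (repr (fl_class t)) t.
Proof. by apply/(@eqmodP _ _ (repr _) t); rewrite reprK. Qed.

Lemma fl_le_class (s t : lterm X) : fl_le (fl_class s) (fl_class t) = lterm_le s t.
Proof.
have /andP[s1 s2] := repr_class_equiv s; have /andP[t1 t2] := repr_class_equiv t.
apply/idP/idP => [h|h].
  exact: lterm_le_trans s2 (lterm_le_trans h t1).
exact: lterm_le_trans s1 (lterm_le_trans h t2).
Qed.

Lemma fl_le_refl : reflexive fl_le.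
Proof. by move=> a; apply: lterm_le_refl. Qed.

Lemma fl_le_trans : transitive fl_le.
Proof. by move=> b a c; apply: lterm_le_trans. Qed.

Lemma fl_le_anti : antisymmetric fl_le.
Proof.
move=> a b ab; rewrite -[a]fl_classK -[b]fl_classK.
exact/(@eqmodP _ (@lterm_equiv X)).
Qed.

HB.instance Definition _ :=
  Order.Le_isPOrder.Build free_lattice_display FL
    fl_le_refl fl_le_anti fl_le_trans.

Lemma fl_classE s t : (fl_class s <= fl_class t) = lterm_le s t.
Proof. exact: fl_le_class. Qed.

Lemma fl_lub_le a b c : (fl_lub a b <= c) = (a <= c) && (b <= c).
Proof. by rewrite -[c]fl_classK [LHS]fl_le_class fl_classK. Qed.

Lemma fl_le_glb c a b : (c <= fl_glb a b) = (c <= a) && (c <= b).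
Proof. by rewrite -[c]fl_classK [LHS]fl_le_class lterm_le_meetr fl_classK. Qed.

HB.instance Definition _ :=
  Order.POrder_MeetJoin_isLattice.Build free_lattice_display FL
    fl_le_glb fl_lub_le.

Definition fl_gen (x : X) : FL := fl_class (LVar x).

Lemma fl_class_join (s t : lterm X) :
  fl_class (LJoin s t) = fl_class s `|` fl_class t.
Proof.
apply/le_anti/andP; split; last first.
  by rewrite leUx !fl_classE lterm_le_joinl ?lterm_le_joinr ?lterm_le_refl.
rewrite -[X in _ <= X]fl_classK fl_classE /=.
by rewrite -!fl_classE fl_classK leUl leUr.
Qed.

Lemma fl_class_meet (s t : lterm X) :
  fl_class (LMeet s t) = fl_class s `&` fl_class t.
Proof.
apply/le_anti/andP; split.
  by rewrite lexI !fl_classE !lterm_le_meetl ?lterm_le_refl ?orbT.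
rewrite -[X in X <= _]fl_classK fl_classE lterm_le_meetr.
by rewrite -!fl_classE fl_classK leIl leIr.
Qed.

Lemma fl_whitman : whitman FL.
Proof.
move=> a b c d; rewrite -[a]fl_classK -[b]fl_classK -[c]fl_classK -[d]fl_classK.
rewrite -fl_class_join -fl_class_meet !fl_classE.
by case/or4P; [constructor 1|constructor 2|constructor 3|constructor 4].
Qed.

Lemma fl_gen_join_prime (x : X) (c d : FL) :
  fl_gen x <= c `|` d -> fl_gen x <= c \/ fl_gen x <= d.
Proof.
rewrite -[c]fl_classK -[d]fl_classK -fl_class_join.
by rewrite !fl_classE => /orP.
Qed.

Section Evaluation.
Context {d : Order.disp_t} (M : latticeType d) (f : X -> M).

Fixpoint lterm_eval (t : lterm X) : M :=
  match t with
  | LVar x => f x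
  | LJoin t1 t2 => lterm_eval t1 `|` lterm_eval t2
  | LMeet t1 t2 => lterm_eval t1 `&` lterm_eval t2
  end.

Lemma lterm_eval_le s t : lterm_le s t -> lterm_eval s <= lterm_eval t.
Proof.
elim: s t => [x|s1 IH1 s2 IH2|s1 IH1 s2 IH2] t.
- elim: t => /= [y /eqP -> //|t1 IH1 t2 IH2|t1 IH1 t2 IH2].
    by case/orP=> [/IH1|/IH2] h; apply: lexU2; rewrite h ?orbT.
  by rewrite lexI => /andP[/IH1 -> /IH2 ->].
- by move=> /= /andP[/IH1 h1 /IH2 h2]; rewrite leUx h1.
- elim: t => [y|t1 IHt1 t2 IHt2|t1 IHt1 t2 IHt2].
  + by case/orP=> [/IH1|/IH2] h; apply: leIx2; rewrite h ?orbT.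
  + case/or4P=> [/IH1 h|/IH2 h|/IHt1 h|/IHt2 h].
    * by apply: leIx2; rewrite h.
    * by apply: leIx2; rewrite h orbT.
    * by apply: lexU2; rewrite h.
    * by apply: lexU2; rewrite h orbT.
  + by rewrite lterm_le_meetr [lterm_eval (LMeet t1 _)]/= lexI
      => /andP[/IHt1 -> /IHt2 ->].
Qed.

Definition fl_lift (a : FL) : M := lterm_eval (repr a).

Lemma fl_lift_class t : fl_lift (fl_class t) = lterm_eval t.
Proof.
have /andP[h1 h2] := repr_class_equiv t.
by apply/le_anti; rewrite !lterm_eval_le.
Qed.

Lemma fl_lift_le : {homo fl_lift : a b / a <= b}.
Proof. by move=> a b; apply: lterm_eval_le. Qed.

Lemma fl_liftI : {morph fl_lift : a b / a `&` b}.
Proof.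
by move=> a b; rewrite -[a]fl_classK -[b]fl_classK -fl_class_meet !fl_lift_class.
Qed.

Lemma fl_liftU : {morph fl_lift : a b / a `|` b}.
Proof.
by move=> a b; rewrite -[a]fl_classK -[b]fl_classK -fl_class_join !fl_lift_class.
Qed.

HB.instance Definition _ := Order.isOrderMorphism.Build _ FL _ M fl_lift fl_lift_le.
HB.instance Definition _ := Order.isLatticeMorphism.Build _ FL _ M fl_lift
  fl_liftI fl_liftU.

End Evaluation.

Lemma fl_freely_generated : freely_generated fl_gen.
Proof.
move=> d M f; exists (fl_lift f : {lmorphism FL -> M}) => [x|h hf a].
  exact: fl_lift_class.
rewrite -[a]fl_classK [RHS]fl_lift_class.
elim: (repr a) => [x|t1 IH1 t2 IH2|t1 IH1 t2 IH2] /=; first by rewrite -hf.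
  by rewrite fl_class_join -IH1 -IH2; apply: omorphU.
by rewrite fl_class_meet -IH1 -IH2; apply: omorphI.
Qed.

End FreeLattice.

(** * Minimal pairs and join covers *)

Section MinimalPairTheory.
Context {d : Order.disp_t} (L : finTBLatticeType d).
Implicit Types (a b : L) (A B C : {set L}).

Lemma refinesP A B :
  reflect (forall x, x \in A -> exists2 y, y \in B & x <= y) (refines A B).
Proof.
apply: (iffP forall_inP) => h x xA.
  by have /exists_inP[y] := h x xA; exists y.
by have [y yB xy] := h x xA; apply/exists_inP; exists y.
Qed.

Lemma refines_refl A : refines A A.
Proof. by apply/refinesP => x xA; exists x. Qed.

Lemma refines_trans B A C : refines A B -> refines B C -> refines A C.
Proof.
move=> /refinesP AB /refinesP BC; apply/refinesP => x /AB[y /BC[z zC yz] xy].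
by exists z => //; apply: le_trans yz.
Qed.

Lemma refines1P a B : reflect (exists2 b, b \in B & a <= b) (refines [set a] B).
Proof.
apply: (iffP (refinesP _ _)) => [h|h x /set1P->] //.
by apply: h; rewrite set11.
Qed.

Lemma refines_joins A B :
  refines A B -> \join_(x in A) x <= \join_(x in B) x.
Proof.
move=> /refinesP AB; apply/joinsP => x /AB[y yB xy].
exact: (joins_min yB).
Qed.

Definition minimal_pairb a B : bool :=
  (a <= \join_(b in B) b) &&
  [forall B' : {set L},
     (a <= \join_(b in B') b) ==> refines B' B ==> (B \subset B')].

Lemma minimal_pairP a B : reflect (minimal_pair a B) (minimal_pairb a B).
Proof.
apply: (iffP andP) => -[aB mB]; split=> //.
  by move=> B' h1 h2; move/forallP/(_ B'): mB; rewrite h1 h2.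
by apply/forallP => B'; apply/implyP => h1; apply/implyP; apply: mB.
Qed.

(** Among the covers of [a] refining [B], [C] has the smallest down-set and then the fewest
    elements. So [C] is an antichain, and a cover [B'] refining [C] has the same down-set, hence
    contains its maximal elements, which form [C]. *)
Lemma minimal_pair_refinement a B :
  a <= \join_(b in B) b -> exists2 C, minimal_pair a C & refines C B.
Proof.
pose down C := #|[set x | refines [set x] C]|.
pose cover C := (a <= \join_(c in C) c) && refines C B.
(* As [#|C| <= #|L|], this orders down-set size and cardinality lexicographically. *)
pose weight C := (down C * #|L|.+1 + #|C|)%N.
move=> aB; have coverB : cover B by rewrite /cover aB refines_refl.
have [C /andP[aC CB] Cmin] := arg_minnP weight coverB.
exists C => //; split=> // B' aB' B'C; apply/subsetP => c cC.
have coverB' : cover B' by rewrite /cover aB' (refines_trans B'C).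
have downsub : [set x | refines [set x] B'] \subset [set x | refines [set x] C].
  by apply/subsetP => x; rewrite !inE => h; apply: refines_trans B'C.
have down_eq : [set x | refines [set x] B'] = [set x | refines [set x] C].
  apply/eqP; rewrite eqEcard downsub leqNgt; apply/negP => lt.
  have := Cmin B' coverB'; rewrite leqNgt => /negP; apply.
  rewrite /weight -/(down C) -/(down B') in lt *.
  apply: (@leq_trans ((down B').+1 * #|L|.+1)).
    by rewrite mulSn addnC -addSn leq_add2r ltnS max_card.
  by apply: leq_trans (leq_addr _ _); rewrite leq_mul2r lt orbT.
have inC x y : x \in C -> y \in C -> x <= y -> x = y.
  move=> xC yC xy; apply/eqP/negPn/negP => neq.
  have CD : refines C (C :\ x).
    apply/refinesP => z zC; have [->|zx] := eqVneq z x.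
      by exists y; rewrite // !inE eq_sym neq.
    by exists z; rewrite // !inE zx.
  have DC : refines (C :\ x) C.
    by apply/refinesP => z /setD1P[_ zC]; exists z.
  have coverD : cover (C :\ x).
    by rewrite /cover (le_trans aC (refines_joins CD)) (refines_trans DC).
  have := Cmin _ coverD; rewrite leqNgt => /negP; apply.
  rewrite /weight (_ : down (C :\ x) = down C); last first.
    apply: eq_card => z; rewrite !inE.
    by apply/idP/idP => h; apply: refines_trans h _.
  by rewrite ltn_add2l [X in (_ < X)%N](cardsD1 x) xC.
have : c \in [set x | refines [set x] B'].
  by rewrite down_eq inE; apply/refines1P; exists c.
rewrite inE => /refines1P[b' b'B' cb'].
have [c' c'C b'c'] := refinesP _ _ B'C b' b'B'.
have cc' := inC _ _ cC c'C (le_trans cb' b'c').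
by rewrite (_ : c = b') //; apply/le_anti; rewrite cb' [X in _ <= X]cc'.
Qed.

Lemma minimal_pair_trivial a B :
  minimal_pair a B -> refines [set a] B -> B = [set a] \/ B = set0.
Proof.
move=> [_ mB] aB; have : B \subset [set a].
  by apply: mB => //; rewrite big_set1.
by rewrite subset1 => /orP[]/eqP; [left|right].
Qed.

Lemma minimal_pair_refines1 a b B :
  minimal_pair a B -> b \in B -> refines [set a] B -> b = a.
Proof.
move=> mB bB /(minimal_pair_trivial mB)[] BE; move: bB; rewrite BE ?inE //.
by move/eqP.
Qed.

(** Replacing [b] in [B] by a cover [B'] of [b] that refines [[set b]] yields a competitor of [B],
    so [b] is in [B']. Members of minimal pairs are thus join irreducible, which makes the padding
    pairs [<b; {b}>] available. *)
Lemma minimal_pair_self a b B : minimal_pair a B -> b \in B -> minimal_pair b [set b].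
Proof.
move=> [aB mB] bB; split; first by rewrite big_set1.
move=> B' bB' /refinesP B'b; rewrite sub1set.
have /subsetP/(_ b bB) : B \subset (B :\ b) :|: B'.
  apply: mB.
    apply: le_trans aB _; apply/joinsP => x xB; rewrite joins_setU.
    have [->|xb] := eqVneq x b; first by rewrite lexU2 // bB' orbT.
    by rewrite lexU2 // (@joins_sup _ _ _ x) // !inE xb.
  apply/refinesP => x /setUP[/setD1P[_ xB]|/B'b[y /set1P-> xb]]; first by exists x.
  by exists b.
by rewrite !inE eqxx.
Qed.

End MinimalPairTheory.

Section JoinCovers.
Context {d d' : Order.disp_t} (L : finTBLatticeType d) (K : latticeType d').

(** The predicate [Q] collects the ways for [x] to lie below a join without being below a joinand:
    none for a generator, those through a meet factor under (W). *)
Lemma join_covered (g : L -> K) (x : K) (Q : pred K) (B : {set L}) :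
    {morph g : a b / a `|` b >-> a `|` b} ->
    {homo Q : a b / a <= b >-> a ==> b} ->
    (forall a b, x <= a `|` b -> [\/ Q (a `|` b), x <= a | x <= b]) ->
    B != set0 -> x <= g (\join_(b in B) b) ->
  Q (g (\join_(b in B) b)) \/ exists2 b, b \in B & x <= g b.
Proof.
move=> gU Qle xQ /set0Pn[b0 b0B].
rewrite -big_enum /=; have: b0 \in enum B by rewrite mem_enum.
have: {subset enum B <= B} by move=> z; rewrite mem_enum.
elim: (enum B) b0 {b0B} => // b s IH b0 sB _; rewrite big_cons.
have bB : b \in B by apply: sB; rewrite mem_head.
(* The induction ends at a singleton: an empty tail would leave only [x <= g \bot], which gives no
   member of [B]. *)
case: s IH sB => [|c s] IH sB.
  by rewrite big_nil joinx0; right; exists b.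
rewrite gU => /xQ[h|h|h]; [by left|by right; exists b|].
have sB' : {subset c :: s <= B}.
  by move=> z zs; apply: sB; rewrite inE zs orbT.
case: (IH c sB' (mem_head _ _) h) => h'; [left|by right].
by apply: (implyP (Qle _ _ (leUr (g (\join_(i <- c :: s) i)) (g b)))).
Qed.

Lemma whitman_cover (a b : K) (g : L -> K) (B : {set L}) :
    whitman K -> {morph g : x y / x `|` y >-> x `|` y} -> B != set0 ->
    a `&` b <= g (\join_(x in B) x) ->
  [\/ a <= g (\join_(x in B) x), b <= g (\join_(x in B) x)
    | exists2 x, x \in B & a `&` b <= g x].
Proof.
move=> W gU B0 h.
case: (@join_covered g (a `&` b) (fun y => (a <= y) || (b <= y)) B) => //.
- move=> y z yz; apply/implyP => /orP[]h'; apply/orP.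
    by left; apply: le_trans yz.
  by right; apply: le_trans yz.
- by move=> c e /W[->|->|?|?]; rewrite ?orbT; [constructor 1..|constructor 2|constructor 3].
- by case/orP; [constructor 1|constructor 2].
- by constructor 3.
Qed.

End JoinCovers.

(** * Join-preserving sections *)

Lemma big_meetP {d : Order.disp_t} (K : latticeType d) (I : finType)
    (P : pred I) (F : I -> K) (z x : K) :
  reflect (x <= z /\ forall i, P i -> x <= F i)
          (x <= \big[Order.meet/z]_(i | P i) F i).
Proof.
rewrite -big_filter; set s := filter P _.
have sP i : (i \in s) = P i by rewrite mem_filter mem_index_enum andbT.
have -> : x <= \big[Order.meet/z]_(i <- s) F i = (x <= z) && all (fun i => x <= F i) s.
  elim: (s) => [|i t IH]; first by rewrite big_nil andbT.
  by rewrite big_cons lexI IH /= andbCA.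
apply: (iffP andP) => -[xz] => [/allP h|h]; split=> //.
  by move=> i; rewrite -sP => /h.
by apply/allP => i; rewrite sP => /h.
Qed.

Lemma big_joinP {d : Order.disp_t} (K : latticeType d) (I : finType)
    (P : pred I) (F : I -> K) (z x : K) :
  reflect (z <= x /\ forall i, P i -> F i <= x)
          (\big[Order.join/z]_(i | P i) F i <= x).
Proof. exact: (@big_meetP _ K^d). Qed.

Section JoinLift.
Context {d d' : Order.disp_t} (L : finTBLatticeType d) (K : latticeType d').
Variables (r : L -> nat) (f : L -> K).
Hypothesis r_lt : forall a B b,
  minimal_pair a B -> a \notin B -> b \in B -> (r b < r a)%N.
Hypothesis f_le : {homo f : a b / a <= b}.
Implicit Types (a b : L) (B C : {set L}).

(* By [r_lt] the value at [a] is stationary once [n] exceeds [r a].  Joins over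
   [B] start from [f \bot] as [K] need not be bounded. *)
Fixpoint join_lift_rec n a : K :=
  if n is n.+1 then
    \big[Order.meet/f a]_(B | minimal_pairb a B && (a \notin B))
      \big[Order.join/f \bot]_(b in B) join_lift_rec n b
  else f a.

Definition join_lift a : K := join_lift_rec (r a).+1 a.

Definition join_lift_set B : K := \big[Order.join/f \bot]_(b in B) join_lift b.

Lemma join_lift_recE n a : (r a < n)%N -> join_lift_rec n a = join_lift a.
Proof.
suff rec_eq m : (r a < n)%N -> (r a < m)%N -> join_lift_rec n a = join_lift_rec m a.
  by move=> an; apply: rec_eq.
elim: n m a => [|n IH] [|m] a; rewrite ?ltn0 // !ltnS => an am /=.
apply: eq_bigr => B /andP[/minimal_pairP mB aB]; apply: eq_bigr => b bB.
have rba := r_lt mB aB bB.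
by rewrite (IH m) //; [apply: leq_trans rba an|apply: leq_trans rba am].
Qed.

Lemma join_liftE a : join_lift a =
  \big[Order.meet/f a]_(B | minimal_pairb a B && (a \notin B)) join_lift_set B.
Proof.
apply: eq_bigr => B /andP[/minimal_pairP mB aB]; apply: eq_bigr => b bB.
exact: join_lift_recE (r_lt mB aB bB).
Qed.

Lemma join_liftP x a : reflect
  (x <= f a /\ forall B, minimal_pair a B -> a \notin B -> x <= join_lift_set B)
  (x <= join_lift a).
Proof.
rewrite join_liftE; apply: (iffP (big_meetP _ _ _ _)) => -[xa xB]; split=> // B.
  by move=> /minimal_pairP mB aB; apply: xB; rewrite mB.
by move=> /andP[/minimal_pairP mB aB]; apply: xB.
Qed.

Lemma join_lift_le_base a : join_lift a <= f a.
Proof. by have /join_liftP[] := lexx (join_lift a). Qed.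

Lemma join_lift_le_set a B :
  minimal_pair a B -> a \notin B -> join_lift a <= join_lift_set B.
Proof. by have /join_liftP[_] := lexx (join_lift a); apply. Qed.

Lemma bot_le_join_lift_set B : f \bot <= join_lift_set B.
Proof. by have /big_joinP[] := lexx (join_lift_set B). Qed.

Lemma le_join_lift_set b B : b \in B -> join_lift b <= join_lift_set B.
Proof. by have /big_joinP[_] := lexx (join_lift_set B); apply. Qed.

Lemma bot_le_join_lift a : f \bot <= join_lift a.
Proof.
by apply/join_liftP; split=> [|B _ _]; rewrite ?f_le ?bot_le_join_lift_set.
Qed.

(** Induction on [r a + r b]. A nontrivial pair [<b; B>] covers [a], so some minimal pair [<a; C>]
    has [C] refining [B]; comparing members of [C] with members of [B] lowers the sum, even if [a]
    itself is in [C]. *)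
Lemma join_lift_le : {homo join_lift : a b / a <= b}.
Proof.
move=> a b; have [n] := ubnP (r a + r b); elim: n a b => // n IH a b rab ab.
apply/join_liftP; split=> [|B mB bB].
  exact: le_trans (join_lift_le_base a) (f_le ab).
have [C mC /refinesP CB] := minimal_pair_refinement (le_trans ab mB.1).
have [aC|aC] := boolP (a \in C).
  have [b' b'B ab'] := CB a aC; apply: le_trans (le_join_lift_set b'B).
  by apply: IH => //; rewrite -ltnS; apply: leq_trans rab; rewrite ltnS ltn_add2l (r_lt mB).
apply: le_trans (join_lift_le_set mC aC) _.
apply/big_joinP; split=> [|c cC]; first exact: bot_le_join_lift_set.
have [b' b'B cb'] := CB c cC; apply: le_trans (le_join_lift_set b'B).
apply: IH => //; rewrite -ltnS; apply: leq_trans rab; rewrite ltnS.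
exact: leq_add (r_lt mC aC cC) (ltnW (r_lt mB bB b'B)).
Qed.

(** This extends the inequality built into [join_lift] from nontrivial minimal pairs to all covers;
    preservation of joins is the case of a two-element cover. *)
Lemma join_lift_cover a B :
  a <= \join_(b in B) b -> join_lift a <= join_lift_set B.
Proof.
move=> /minimal_pair_refinement[C mC /refinesP CB].
have [aC|aC] := boolP (a \in C).
  by have [b bB /join_lift_le/le_trans->] := CB a aC; rewrite ?le_join_lift_set.
apply: le_trans (join_lift_le_set mC aC) _.
apply/big_joinP; split=> [|c cC]; first exact: bot_le_join_lift_set.
by have [b bB /join_lift_le/le_trans->] := CB c cC; rewrite ?le_join_lift_set.
Qed.

Lemma join_liftU : {morph join_lift : a b / a `|` b}.
Proof.
move=> a b; apply/le_anti/andP; split; last first.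
  by rewrite leUx !join_lift_le ?leUl ?leUr.
have /join_lift_cover/le_trans : a `|` b <= \join_(x in [set a; b]) x.
  by rewrite leUx !joins_sup ?set21 ?set22.
apply; apply/big_joinP; split=> [|x].
  by rewrite lexU2 // bot_le_join_lift.
by case/set2P=> ->; rewrite ?leUl ?leUr.
Qed.

Lemma join_liftI :
  whitman L -> {morph f : a b / a `&` b} -> {morph join_lift : a b / a `&` b}.
Proof.
move=> W fI a b; apply/le_anti/andP; split.
  by rewrite lexI !join_lift_le ?leIl ?leIr.
have base : join_lift a `&` join_lift b <= f (a `&` b).
  by rewrite fI leI2 ?join_lift_le_base.
apply/join_liftP; split=> // B mB abB.
(* An empty [B] forces the meet to be [\bot], and the starting value [f \bot] then suffices. *)
have [B0|B0] := eqVneq B set0.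
  apply: le_trans (bot_le_join_lift_set B); apply: (le_trans base); apply: f_le.
  by move: mB.1; rewrite B0 big_set0.
case: (whitman_cover (g := id) W _ B0 mB.1) => // [aB|bB|[x xB abx]].
- by rewrite (le_trans (leIl _ _)) ?join_lift_cover.
- by rewrite (le_trans (leIr _ _)) ?join_lift_cover.
- case/negP: abB; rewrite -(minimal_pair_refines1 mB xB) //.
  by apply/refines1P; exists x.
Qed.

(** One inequality holds because [join_lift] lies below [f]. For the other, each factor of the meet
    evaluates above [a], by induction on the rank. *)
Lemma join_lift_section (p : K -> L) :
    {homo p : x y / x <= y} -> {morph p : x y / x `&` y} ->
    {morph p : x y / x `|` y} -> cancel f p ->
  cancel join_lift p.
Proof.
move=> p_le pI pU fK a.
suff [n]: {n | r a < n}%N.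
  elim: n a => // n IH a ra; apply/le_anti; rewrite -[X in _ <= X]fK.
  rewrite p_le ?join_lift_le_base //= join_liftE.
  apply: (big_ind (fun y => a <= p y)) => [|x y ax ay|B].
  - by rewrite fK.
  - by rewrite pI lexI ax.
  move=> /andP[/minimal_pairP mB aB]; apply: le_trans mB.1 _.
  apply/joinsP => b bB; rewrite -[b in b <= _](IH b).
    exact: p_le (le_join_lift_set bB).
  by rewrite -ltnS; apply: leq_trans ra; rewrite ltnS (r_lt mB).
by exists (r a).+1.
Qed.

End JoinLift.

(** * Finite sublattices of free lattices *)

Section SublatticeOfFree.
Context {d : Order.disp_t} (L : finTBLatticeType d) (X : choiceType).
Variable g : L -> free_lattice X.
Hypotheses (gI : {morph g : a b / a `&` b}) (gU : {morph g : a b / a `|` b})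
  (g_inj : injective g).

(** The approximation t^ is a relation because a term not below [g \top] has none. *)
Definition upper_approx (t : lterm X) (a : L) : Prop :=
  forall x, (fl_class t <= g x) = (a <= x).

Lemma morph_inj_le a b : (g a <= g b) = (a <= b).
Proof. by rewrite !leEmeet -gI (inj_eq g_inj). Qed.

Lemma upper_approx_exists t b :
  fl_class t <= g b -> exists2 a, upper_approx t a & a <= b.
Proof.
move=> tb; pose P x := fl_class t <= g x.
have Pa : P (\meet_(x | P x) x).
  apply: (big_ind P) => // [|x y Px Py]; last first.
    by rewrite /P gI lexI; apply/andP.
  (* The empty meet is [\top]; the class of [t] lies below [g \top] only thanks to [b]. *)
  by apply: le_trans tb _; rewrite morph_inj_le lex1.
exists (\meet_(x | P x) x); last exact: meets_inf.
move=> x; apply/idP/idP => [Px|ax]; first exact: meets_inf.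
by apply: (le_trans Pa); rewrite morph_inj_le.
Qed.

(** Keeping the case [t = u] apart from smaller size matters: equal terms have equal approximations,
    so any change of approximation costs size. *)
Definition has_subterm_cover (u : lterm X) (B : {set L}) : Prop :=
  exists A : {set L}, [/\ refines A B, fl_class u <= g (\join_(a in A) a)
    & forall a, a \in A ->
      exists2 t, t = u \/ (lterm_size t < lterm_size u)%N & upper_approx t a].

Lemma subterm_cover_below u b (B : {set L}) :
  b \in B -> fl_class u <= g b -> has_subterm_cover u B.
Proof.
move=> bB /upper_approx_exists[a ua ab]; exists [set a]; split.
- by apply/refines1P; exists b.
- by rewrite big_set1 ua.
- by move=> _ /set1P->; exists u; first by left.
Qed.

Lemma subterm_cover_le u v (B : {set L}) :
    (lterm_size v < lterm_size u)%N -> fl_class u <= fl_class v ->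
  has_subterm_cover v B -> has_subterm_cover u B.
Proof.
move=> vu uv [A [AB vA h]]; exists A; split=> // [|a /h[t tv ta]].
  exact: le_trans vA.
by exists t => //; right; case: tv => [->//|/ltn_trans]; apply.
Qed.

Lemma subterm_cover_join u v (B : {set L}) :
    has_subterm_cover u B -> has_subterm_cover v B ->
  has_subterm_cover (LJoin u v) B.
Proof.
move=> [A1 [/refinesP A1B uA1 h1]] [A2 [/refinesP A2B vA2 h2]].
exists (A1 :|: A2); split.
- by apply/refinesP => x /setUP[/A1B|/A2B].
- by rewrite fl_class_join joins_setU gU leU2.
- move=> a /setUP[/h1|/h2] [t tu ta]; exists t => //; right; rewrite /= ltnS.
    by apply: leq_trans (leq_addr _ _); case: tu => [->//|/ltnW].
  by apply: leq_trans (leq_addl _ _); case: tu => [->//|/ltnW].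
Qed.

(** Generators are join prime, the covers of two joinands are united, and for a meet (W) leads to
    one factor or to a single member of [B]. *)
Lemma subterm_cover u (B : {set L}) :
    B != set0 -> fl_class u <= g (\join_(b in B) b) -> has_subterm_cover u B.
Proof.
move=> B0; elim: u => [x|u1 IH1 u2 IH2|u1 IH1 u2 IH2] uB.
- case: (@join_covered _ _ _ _ g (fl_class (LVar x)) pred0 B gU _ _ B0 uB) => //.
    by move=> a b /fl_gen_join_prime[]; [constructor 2|constructor 3].
  by case=> b; apply: subterm_cover_below.
- move: uB; rewrite fl_class_join leUx => /andP[/IH1 h1 /IH2 h2].
  exact: subterm_cover_join.
- rewrite fl_class_meet in uB.
  case: (whitman_cover (@fl_whitman X) gU B0 uB) => [/IH1|/IH2|[b bB]].
  + apply: subterm_cover_le; first by rewrite /= ltnS leq_addr.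
    by rewrite fl_class_meet leIl.
  + apply: subterm_cover_le; first by rewrite /= ltnS leq_addl.
    by rewrite fl_class_meet leIr.
  + by rewrite -fl_class_meet; apply: subterm_cover_below.
Qed.

(** The subterm cover refines [B] and its join is above [a], so minimality puts all of [B] inside
    it. *)
Lemma upper_approx_descent t a (B : {set L}) b :
    upper_approx t a -> minimal_pair a B -> b \in B ->
  exists2 t', t' = t \/ (lterm_size t' < lterm_size t)%N & upper_approx t' b.
Proof.
move=> ta [aB mB] bB; have B0 : B != set0 by apply/set0Pn; exists b.
have [|A [AB tA]] := @subterm_cover t B B0; first by rewrite ta.
by apply; apply: (subsetP (mB A _ AB)) bB; rewrite -ta.
Qed.

Lemma upper_approx_inj t a b : upper_approx t a -> upper_approx t b -> a = b.
Proof. by move=> ta tb; apply/le_anti; rewrite -ta tb lexx -tb ta lexx. Qed.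

Lemma iter_ordS n m (k : 'I_n) : iter m (@ordS n) k = (k + m) %% n :> nat.
Proof.
elim: m => [|m IH] /=; first by rewrite addn0 modn_small.
by rewrite IH -addn1 modnDml addn1 addnS.
Qed.

Lemma minimal_pair_cycle_constant n (p : 'I_n -> L) (J : 'I_n -> {set L}) k :
  minimal_pair_cycle p J -> p (ordS k) = p k.
Proof.
move=> [mJ pJ].
have step t j : upper_approx t (p j) ->
    exists2 t', t' = t \/ (lterm_size t' < lterm_size t)%N
      & upper_approx t' (p (ordS j)).
  by move=> tj; apply: upper_approx_descent tj (mJ j) (pJ j).
have steps t j m : upper_approx t (p j) ->
    exists2 t', (lterm_size t' <= lterm_size t)%N
      & upper_approx t' (p (iter m (@ordS n) j)).
  move=> tj; elim: m => [|m [t' t't /step[t'' t''t' h]]]; first by exists t.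
  by exists t'' => //; case: t''t' => [->//|/ltnW/leq_trans->].
apply/eqP/negPn/negP => neq.
have strict t : upper_approx t (p k) ->
    exists2 t', (lterm_size t' < lterm_size t)%N & upper_approx t' (p k).
  move=> tk; have [t' t't tk'] := step t k tk.
  have {t't}t't : (lterm_size t' < lterm_size t)%N.
    case: t't => // tt; case/eqP: neq; apply: upper_approx_inj tk' _.
    by rewrite tt.
  (* One strict step has been made; [n.-1] more lead back to [p k] with a shorter term, which starts
     an infinite descent. *)
  have [t'' t''t' h] := steps t' (ordS k) n.-1 tk'.
  exists t''; first exact: leq_ltn_trans t't.
  suff <- : iter n.-1 (@ordS n) (ordS k) = k by [].
  have n0 : (0 < n)%N := leq_ltn_trans (leq0n k) (ltn_ord k).
  rewrite -iterSr prednK //; apply: ord_inj; rewrite iter_ordS.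
  by rewrite modnDr modn_small.
have [t tk] : exists t, upper_approx t (p k).
  by exists (repr (g (p k))) => x; rewrite fl_classK morph_inj_le.
have [m] := ubnP (lterm_size t); elim: m t tk => // m IH t /strict[t' t't /IH h] tm.
by apply: h; rewrite -ltnS; apply: leq_trans tm; rewrite ltnS.
Qed.

End SublatticeOfFree.

(** * A rank function for dependency in a lattice without the forbidden cycles *)

Section DependencyRank.
Context {d : Order.disp_t} (L : finTBLatticeType d).
Hypothesis no_cycle : ~ exists (n : nat) (p : 'I_n -> L) (J : 'I_n -> {set L}),
  [/\ (3 <= n)%N, minimal_pair_cycle p J
    & (2 * #|[set k : 'I_n | refines [set p k] (J (ordS k))]| <= n)%N].

(* Trivial pairs are used as padding: from <a; {a}> to a nontrivial <a; B>, and
   from a nontrivial <a; B> to <b; {b}> with [b] in [B], the final conjunct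
   always holds, so cycles alternating the two kinds have zero count. *)
Definition pair_edge : rel (L * {set L}) := fun x y =>
  [&& minimal_pairb x.1 x.2, y.1 \in x.2 & ~~ refines [set x.1] y.2].

Lemma pair_edge_acyclic x y : pair_edge x y -> ~~ connect pair_edge y x.
Proof.
move=> xy; apply/negP => /connectP[s yx xE]; apply: no_cycle.
pose n := (size s).+1; pose v i := nth y (y :: s) i.
have edge (k : 'I_n) : pair_edge (v k) (v (ordS k)).
  have : path pair_edge y (rcons s y) by rewrite rcons_path yx -xE.
  move/(pathP y)/(_ k); rewrite size_rcons => /(_ (ltn_ord k)).
  rewrite -rcons_cons nth_rcons /= ltn_ord -/(v k); congr (pair_edge _ _).
  rewrite nth_rcons /v; have := ltn_ord k; rewrite ltnS leq_eqVlt => /orP[/eqP->|ks].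
    by rewrite ltnn eqxx modnn.
  by rewrite ks modn_small // ltnS.
exists n, (fun k => (v k).1), (fun k => (v k).2); split.
(* In a closed walk of length one or two, the first component of [x] belongs to the set of [y],
   against the last conjunct of the edge from [x] to [y]. *)
- rewrite !ltnS; case: s xE yx {n v edge} => [|z [|//]] /= xE.
    have /and3P[_ h /negP[]] := xy; rewrite xE in h *.
    by apply/refines1P; exists y.1.
  rewrite -xE andbT => /and3P[_ h _]; have /and3P[_ _ /negP[]] := xy.
  by apply/refines1P; exists x.1.
- by split=> k; have /and3P[/minimal_pairP] := edge k.
- rewrite (_ : [set k | _] = set0) ?cards0 //.
  by apply/setP => k; rewrite !inE; have /and3P[_ _ /negPf] := edge k.
Qed.

Definition depends : rel L := fun a b =>
  [exists B : {set L}, [&& minimal_pairb a B, a \notin B & b \in B]].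

Lemma depends_edges a b B :
    minimal_pair a [set a] -> minimal_pair a B -> a \notin B -> b \in B ->
  pair_edge (a, [set a]) (a, B) /\ pair_edge (a, B) (b, [set b]).
Proof.
move=> ma mB aB bB.
have naB : ~~ refines [set a] B.
  by apply: contra aB => h; rewrite -{1}(minimal_pair_refines1 mB bB h).
split; apply/and3P; split; rewrite /= ?set11 //; try exact/minimal_pairP.
apply: contra naB => /refines_trans; apply.
by apply/refines1P; exists b.
Qed.

(** Minimality of the trivial pair passes along the path by [minimal_pair_self], and each dependency
    becomes two edges. *)
Lemma connect_depends a b :
    minimal_pair a [set a] -> connect depends a b ->
  minimal_pair b [set b] /\ connect pair_edge (a, [set a]) (b, [set b]).
Proof.
move=> ma /connectP[s]; elim: s a ma => [|c s IH] a ma /=; first by move=> _ ->.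
case/andP=> /existsP[B /and3P[/minimal_pairP mB aB cB]] cs bE.
have [e1 e2] := depends_edges ma mB aB cB.
have [mb cb] := IH c (minimal_pair_self mB cB) cs bE.
by split=> //; apply: connect_trans (connect1 e1) (connect_trans (connect1 e2) cb).
Qed.

Definition depends_rank a := #|[set b | connect depends a b]|.

Lemma depends_rank_lt a B b :
    minimal_pair a B -> a \notin B -> b \in B ->
  (depends_rank b < depends_rank a)%N.
Proof.
move=> mB aB bB.
have ab : depends a b.
  by apply/existsP; exists B; apply/and3P; split=> //; apply/minimal_pairP.
apply: proper_card; apply/properP; split.
  by apply/subsetP => c; rewrite !inE; apply: connect_trans (connect1 ab).
exists a; rewrite !inE ?connect0 //; apply/negP => ba.
(* The return path starts at [b], whose trivial pair is minimal since [b] is in [B]; only this path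
   shows that [<a; {a}>] is minimal too. *)
have [ma ba'] := connect_depends (minimal_pair_self mB bB) ba.
have [e1 e2] := depends_edges ma mB aB bB.
by have /negP := pair_edge_acyclic e1; apply; apply: connect_trans (connect1 e2) ba'.
Qed.

End DependencyRank.

(** * Duality and the section preserving both operations *)

Lemma S_lattice_dual {d : Order.disp_t} (L : finTBLatticeType d) :
  S_lattice L -> S_lattice L^d.
Proof.
move=> [[SJ SM] W]; split; first by split=> x a b c; [apply: SM|apply: SJ].
move=> a b c e /(W c e a b)[h|h|h|h]; first [by constructor 3|by constructor 4
  |by constructor 1|by constructor 2].
Qed.

Section LatticeSection.
Context {d : Order.disp_t} (L : finTBLatticeType d).
Variables (r : L -> nat) (r' : L^d -> nat).
Hypothesis r_lt : forall a B b,
  minimal_pair a B -> a \notin B -> b \in B -> (r b < r a)%N.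
Hypothesis r'_lt : forall (a : L^d) B b,
  minimal_pair a B -> a \notin B -> b \in B -> (r' b < r' a)%N.

Let FL := free_lattice L.
Let eval : FL -> L := fl_lift id.

(** Sending [a] to its generator is not monotone in general; meeting over all [b] above [a] repairs
    this. The starting value is already a factor, as [a <= \top]. *)
Definition meet_gens (a : L) : FL :=
  \big[Order.meet/fl_gen \top]_(b | a <= b) fl_gen b.

Lemma meet_gens_le : {homo meet_gens : a b / a <= b}.
Proof.
move=> a b ab; have /big_meetP[h1 h2] := lexx (meet_gens a).
by apply/big_meetP; split=> // c /(le_trans ab); apply: h2.
Qed.

Lemma meet_gensK : cancel meet_gens eval.
Proof.
move=> a; have evalE x : eval (fl_gen x) = x by apply: fl_lift_class.
apply/le_anti/andP; split.
  have /big_meetP[_ /(_ a (lexx a))] := lexx (meet_gens a).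
  by move/(fl_lift_le id); rewrite -/eval evalE.
apply: (big_ind (fun y => a <= eval y)) => [|x y ax ay|b ab]; rewrite ?evalE ?lex1 //.
by rewrite /eval fl_liftI lexI ax.
Qed.

Definition join_section : L -> FL := join_lift r meet_gens.

(** Over the duals, [join_liftU] yields preservation of meets, and [join_liftI] keeps the joins that
    [join_section] already preserves. *)
Definition lattice_section : L -> FL :=
  @join_lift _ _ L^d FL^d r' join_section.

Let js_le : {homo (join_section : L^d -> FL^d) : a b / a <= b}.
Proof. by move=> a b ab; apply: (join_lift_le r_lt meet_gens_le ab). Qed.

Lemma lattice_sectionI : {morph lattice_section : a b / a `&` b}.
Proof. exact: (@join_liftU _ _ L^d FL^d r' _ r'_lt js_le). Qed.

Lemma lattice_sectionU : whitman L^d -> {morph lattice_section : a b / a `|` b}.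
Proof.
move=> W; apply: (@join_liftI _ _ L^d FL^d r' _ r'_lt js_le W).
exact: (join_liftU r_lt meet_gens_le).
Qed.

Lemma lattice_sectionK : cancel lattice_section eval.
Proof.
apply: (@join_lift_section _ _ L^d FL^d r' _ r'_lt eval).
- by move=> x y; apply: (fl_lift_le (id : L -> L)).
- exact: (fl_liftU (id : L -> L)).
- exact: (fl_liftI (id : L -> L)).
- apply: (join_lift_section r_lt).
  + exact: fl_lift_le.
  + exact: fl_liftI.
  + exact: fl_liftU.
  + exact: meet_gensK.
Qed.

End LatticeSection.

(** * Embeddings obtained from sections, and the equivalence *)

Lemma lmorphismP {d d' : Order.disp_t} (K : latticeType d) (M : latticeType d')
    (g : K -> M) :
    {morph g : a b / a `&` b} -> {morph g : a b / a `|` b} ->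
  exists h : {lmorphism K -> M}, h = g :> (K -> M).
Proof.
move=> gI gU; have g_le : {homo g : a b / a <= b}.
  by move=> a b; rewrite !leEmeet -gI => /eqP ->.
pose og : {omorphism K -> M} :=
  HB.pack g (Order.isOrderMorphism.Build _ K _ M g g_le).
pose lg := Order.isLatticeMorphism.Build _ K _ M og gI gU.
by exists (HB.pack_for {lmorphism K -> M} g og lg).
Qed.

Lemma embeds_in_free_lattice {d : Order.disp_t} (L : finTBLatticeType d)
    (r : L -> nat) (r' : L^d -> nat) :
    (forall a B b,
       minimal_pair a B -> a \notin B -> b \in B -> (r b < r a)%N) ->
    (forall (a : L^d) B b,
       minimal_pair a B -> a \notin B -> b \in B -> (r' b < r' a)%N) ->
    whitman L^d -> isomorphic_to_sublattice L (free_lattice L).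
Proof.
move=> r_lt r'_lt W.
pose eval : free_lattice L -> L := fl_lift id.
pose g := lattice_section r r'.
have gI : {morph g : a b / a `&` b} by apply: lattice_sectionI.
have gU : {morph g : a b / a `|` b} by apply: lattice_sectionU.
have gK : cancel g eval by apply: lattice_sectionK.
(* Since [eval] retracts [g], the image of [g] is the set of fixed points of [g \o eval], which is
   decidable. *)
pose S : {pred free_lattice L} := [pred y | g (eval y) == y].
have SI : {in S &, forall x y, x `&` y \in S}.
  by move=> x y; rewrite !inE /eval fl_liftI gI => /eqP-> /eqP->.
have SU : {in S &, forall x y, x `|` y \in S}.
  by move=> x y; rewrite !inE /eval fl_liftU gU => /eqP-> /eqP->.
pose Sclosed := Order.isLatticeClosed.Build _ (free_lattice L) S SI SU.
pose Smk : latticeClosed (free_lattice L) := HB.pack S Sclosed.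
have [gm gmE] := lmorphismP gI gU.
exists Smk, gm; rewrite gmE; split; first exact: can_inj gK.
move=> y; split=> [/eqP <-|[x <-]]; first by exists (eval y).
by rewrite inE /= gK.
Qed.

Local Close Scope quotient_scope.
Local Close Scope order_scope.

Theorem theorem2 :
  (forall (d : Order.disp_t) (L : finTBLatticeType d),
     semidistributive L -> whitman L ->
     exists (d' : Order.disp_t) (F : latticeType d'),
       is_free_lattice F /\ isomorphic_to_sublattice L F)
  <->
  (forall (d : Order.disp_t) (L : finTBLatticeType d),
     S_lattice L ->
     ~ exists (n : nat) (p : 'I_n -> L) (J : 'I_n -> {set L}),
         [/\ 3 <= n,
             minimal_pair_cycle p J
           & 2 * #|[set k : 'I_n | refines [set p k] (J (ordS k))]| <= n]).
Proof.
split=> [embeds d L [SD W] [n [p [J [n3 pJ]]]]|no_cycle d L SD W].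
  have [d' [F [[X [i Fi]] [S [f [f_inj _]]]]]] := embeds d L SD W.
  (* The generators of [F] form a bare type, so terms are taken over the carrier of [F]. By
     uniqueness [ev \o h] is the identity, hence [h] embeds [F] in a term model. *)
  have [h hi _] := Fi _ (free_lattice F) (fun x => fl_gen (i x)).
  pose ev : {lmorphism free_lattice F -> F} := fl_lift id.
  have hK : cancel h ev.
    have [k _ k_uniq] := Fi _ F i.
    have [k' k'E] : exists k' : {lmorphism F -> F}, k' = ev \o h :> (F -> F).
      by apply: lmorphismP => a b /=; rewrite ?omorphI ?omorphU.
    have id_k := k_uniq (idfun : {lmorphism F -> F}).
    move=> y; rewrite -[RHS]/(idfun y) id_k // -[LHS]/((ev \o h) y) -k'E.
    apply: k_uniq => x; rewrite k'E /= hi; exact: fl_lift_class.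
  have p_const k : p (ordS k) = p k.
    apply: (@minimal_pair_cycle_constant _ L F (h \o f)) pJ.
    - by move=> a b /=; rewrite !omorphI.
    - by move=> a b /=; rewrite !omorphU.
    - exact: inj_comp (can_inj hK) f_inj.
  (* In a constant cycle [p k] equals the value two indices later, which lies in [J (ordS k)]. So
     all indices count, and [2 * n <= n] fails. *)
  rewrite (_ : [set k | _] = setT).
    by rewrite cardsT card_ord leqNgt mul2n -addnn -[X in (X < _)%N]addn0 ltn_add2l
      (leq_trans _ n3).
  apply/setP => k; rewrite !inE; apply/refines1P; exists (p k) => //.
  by rewrite -p_const -p_const; apply: pJ.2.
exists free_lattice_display, (free_lattice L); split.
  by exists L, (@fl_gen L); apply: fl_freely_generated.
have SL : S_lattice L by [].
(* The dual stage needs a rank on [L^d]; (2) supplies it because it ranges over all S-lattices. *)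
have SLd := S_lattice_dual SL.
apply: embeds_in_free_lattice SLd.2.
- exact: depends_rank_lt (no_cycle _ _ SL).
- exact: depends_rank_lt (no_cycle _ _ SLd).
Qed.
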